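(* Let $F$ be admissible on $I=[0,a)$ with $a\in(0,\infty]$. Let $n\ge2$ and assume that $F$-concavity is not stronger than log-concavity in $\mathcal{A}_{\mathbb{R}^n}(I)$, that is, there exists a function $\mathbb{R}^n\to I$ that is $F$-concave in $\mathbb{R}^n$ but not log-concave in $\mathbb{R}^n$. Then there exists an $F$-concave function $\phi\in L^\infty(\mathbb{R}^n)$ such that $e^{t\Delta_{\mathbb{R}^n}}\phi$ is not quasi-concave in $\mathbb{R}^n$ for all small enough $t>0$.
   Context: A function $F:I\to[-\infty,\infty)$ is *admissible* on $I=[0,a)$ if $F$ is continuous on $(0,a)$, strictly increasing on $I$, and $F(0)=-\infty$. $\mathcal{A}_{\mathbb{R}^n}(I)$ is the set of functions $f:\mathbb{R}^n\to\mathbb{R}$ with $f(\mathbb{R}^n)\subset I$. A function $f\in\mathcal{A}_{\mathbb{R}^n}(I)$ is *$F$-concave* in $\mathbb{R}^n$ if $F(f((1-\lambda)x+\lambda y))\ge(1-\lambda)F(f(x))+\lambda F(f(y))$ for all $x,y\in\mathbb{R}^n$, $\lambda\in(0,1)$, with the conventions $-\infty\le-\infty$, $-\infty+b=b-\infty=-\infty$ for $b\in[-\infty,\infty)$, $\kappa\cdot(-\infty)=-\infty$ for $\kappa>0$. A nonnegative $f$ is *log-concave* if $f((1-\lambda)x+\lambda y)\ge f(x)^{1-\lambda}f(y)^\lambda$, and *quasi-concave* if $f((1-\lambda)x+\lambda y)\ge\min\{f(x),f(y)\}$, for all $x,y\in\mathbb{R}^n$, $\lambda\in(0,1)$. $(e^{t\Delta_{\mathbb{R}^n}}\phi)(x):=(4\pi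 t)^{-n/2}\int_{\mathbb{R}^n}e^{-|x-y|^2/(4t)}\phi(y)\,dy$. ''Not quasi-concave for all small enough $t>0$'' means: there is $t_0>0$ such that for every $t\in(0,t_0)$ the function $e^{t\Delta_{\mathbb{R}^n}}\phi$ is not quasi-concave. *)

(* Defs.v *)
From HB Require Import structures.
From mathcomp Require Import all_boot all_order all_algebra.
From mathcomp Require Import all_classical all_reals all_analysis.

Set Implicit Arguments.
Unset Strict Implicit.
Unset Printing Implicit Defensive.

Import Order.TTheory GRing.Theory Num.Theory.
Import numFieldNormedType.Exports.

Local Open Scope classical_set_scope.
Local Open Scope ring_scope.

Section Euclidean.
Context (R : realType).

(* Measurable cylinders with one-dimensional base: they generate the product
   sigma-algebra, which on R^n is the Borel sigma-algebra. *)
Definition cylinders (n : nat) : set (set 'rV[R]_n) :=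
  [set A | exists i (B : set R),
    measurable B /\ A = [set v : 'rV[R]_n | B (v 0 i)]].

Arguments cylinders : clear implicits.

Definition borel_rV (n : nat) : measurableType _ :=
  g_sigma_algebraType (cylinders n).

Definition rVcons (n : nat) (p : measurableTypeR R * borel_rV n) :
    borel_rV n.+1 :=
  row_mx (const_mx p.1 : 'rV_1) (p.2 : 'rV_n).

Definition rVuncons (n : nat) (v : borel_rV n.+1) :
    measurableTypeR R * borel_rV n :=
  (v 0 0, rsubmx (v : 'rV_(1 + n))).

Lemma rVconsK (n : nat) : cancel (@rVcons n) (@rVuncons n).
Proof.
case=> x v; rewrite /rVuncons /rVcons /= row_mxKr; congr pair.
by rewrite mxE; case: splitP => // j _; rewrite mxE.
Qed.

Lemma rVunconsK (n : nat) : cancel (@rVuncons n) (@rVcons n).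
Proof.
move=> v; rewrite /rVcons /rVuncons /=.
apply/rowP => i; rewrite !mxE; case: splitP => j ij; rewrite !mxE.
  by congr (v _ _); apply: val_inj; rewrite /= ij (ord1 j).
by congr (v _ _); apply: val_inj.
Qed.

Lemma rVcons0 (n : nat) (x : R) (v : borel_rV n) : rVcons (x, v) 0 ord0 = x.
Proof. by have [] := rVconsK (x, v). Qed.

Lemma rVconsS (n : nat) (x : R) (v : borel_rV n) (i : 'I_n) :
  rVcons (x, v) 0 (lift ord0 i) = (v : 'rV_n) 0 i.
Proof.
have -> : lift ord0 i = rshift 1 i :> 'I_(1 + n) by exact: val_inj.
exact: row_mxEr.
Qed.

Lemma measurable_coord (n : nat) (i : 'I_n) :
  measurable_fun setT (fun v : borel_rV n => (v 0 i : R)).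
Proof.
move=> _ B mB; rewrite setTI.
by apply: sub_sigma_algebra; exists i, B.
Qed.

Lemma measurable_borel_rV d (T : measurableType d) (n : nat)
    (f : T -> borel_rV n) :
  (forall i, measurable_fun setT (fun x => (f x 0 i : R))) ->
  measurable_fun setT f.
Proof.
move=> mf; apply: (measurability (rT := borel_rV n) (cylinders n)) => //.
move=> _ [_ [i [B [mB ->]]] <-].
exact: mf.
Qed.

Lemma measurable_rVcons (n : nat) : measurable_fun setT (@rVcons n).
Proof.
apply: measurable_borel_rV => i.
have -> : (fun p => rVcons p 0 i : R) =
    (fun p => match fintype.split (i : 'I_(1 + n)) with
              | inl _ => p.1 | inr j => (p.2 : 'rV_n) 0 j end).
  by apply/funext => p; rewrite mxE; case: fintype.split => // j; rewrite mxE.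
case: fintype.split => [_|j]; first exact: measurable_fst.
exact: (measurableT_comp (measurable_coord j) measurable_snd).
Qed.

Lemma measurable_rVuncons (n : nat) : measurable_fun setT (@rVuncons n).
Proof.
apply: measurable_fun_pair; first exact: measurable_coord.
apply: measurable_borel_rV => i.
rewrite (_ : (fun _ => _) = (fun v : borel_rV n.+1 => v 0 (rshift 1 i))).
  exact: measurable_coord.
by apply/funext => v; rewrite mxE.
Qed.

Section step.
Context (n : nat) (mu : {sigma_finite_measure set (borel_rV n) -> \bar R}).

Definition lebesgue_step : set (borel_rV n.+1) -> \bar R :=
  pushforward (@lebesgue_measure R \x mu)%E (@rVcons n).

Let preimage_rVcons (A : set (borel_rV n.+1)) :
  measurable A -> measurable (@rVcons n @^-1` A).
Proof.
by move=> mA; rewrite -[X in measurable X]setTI; exact: measurable_rVcons.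
Qed.

Let step0 : lebesgue_step set0 = 0%E.
Proof. by rewrite /lebesgue_step /pushforward preimage_set0 measure0. Qed.

Let step_ge0 A : (0 <= lebesgue_step A)%E.
Proof. by rewrite /lebesgue_step /pushforward; exact: measure_ge0. Qed.

Let step_sigma_additive : semi_sigma_additive lebesgue_step.
Proof.
move=> F mF tF mUF; rewrite /lebesgue_step /pushforward preimage_bigcup.
apply: measure_semi_sigma_additive.
- by move=> k; exact: preimage_rVcons.
- apply/trivIsetP => /= i j _ _ ij; rewrite -preimage_setI.
  by move/trivIsetP : tF => /(_ _ _ _ _ ij) ->//; rewrite preimage_set0.
- by rewrite -preimage_bigcup; exact: preimage_rVcons.
Qed.

HB.instance Definition _ := isMeasure.Build _ _ _ lebesgue_step
  step0 step_ge0 step_sigma_additive.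

Let step_sigma_finite : sigma_finite setT lebesgue_step.
Proof.
have /sigma_finiteP[F [FT ndF Ffin]] := sigma_finiteT (@lebesgue_measure R).
have /sigma_finiteP[G [GT ndG Gfin]] := sigma_finiteT mu.
exists (fun k => @rVuncons n @^-1` (F k `*` G k)).
  rewrite -preimage_bigcup (_ : \bigcup_k _ = setT) ?preimage_setT//.
  apply/seteqP; split => // -[x y] _.
  have [k _ Fkx] : (\bigcup_k F k) x by rewrite -FT.
  have [l _ Gly] : (\bigcup_k G k) y by rewrite -GT.
  exists (maxn k l) => //; split.
    by move: Fkx; apply/subsetPset/ndF/leq_maxl.
  by move: Gly; apply/subsetPset/ndG/leq_maxr.
move=> k; have [mF finF] := Ffin k; have [mG finG] := Gfin k.
split.
  rewrite -[X in measurable X]setTI; apply: measurable_rVuncons => //.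
  exact: measurableX.
rewrite /lebesgue_step /pushforward -comp_preimage.
rewrite (_ : _ \o _ = id) ?preimage_id.
  by rewrite product_measure1E// lte_mul_pinfty// ge0_fin_numE.
by apply/funext => p /=; rewrite rVconsK.
Qed.

HB.instance Definition _ := Measure_isSigmaFinite.Build _ _ _ lebesgue_step
  step_sigma_finite.

End step.

(* Lebesgue measure on the Borel sets, as an iterated product of the
   one-dimensional one; [borel_lebesgue_rect] below gives its value on boxes. *)
Fixpoint borel_lebesgue (n : nat) :
    {sigma_finite_measure set (borel_rV n) -> \bar R} :=
  if n is n'.+1 then lebesgue_step (borel_lebesgue n') else \d_(0 : borel_rV 0).

Lemma measurable_rect (n : nat) (B : 'I_n -> set R) :
  (forall i, measurable (B i)) ->
  measurable [set v : borel_rV n | forall i, B i (v 0 i)].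
Proof.
move=> mB; have -> : [set v : borel_rV n | forall i, B i (v 0 i)] =
    \bigcap_(i in [set: 'I_n]) ((fun v : borel_rV n => v 0 i) @^-1` B i).
  by apply/seteqP; split => v h i; [move=> _; exact: h|exact: h].
apply: fin_bigcap_measurable; first exact: finite_finset.
by move=> i _; rewrite -[X in measurable X]setTI; exact: measurable_coord.
Qed.

Lemma borel_lebesgue_rect (n : nat) (B : 'I_n -> set R) :
  (forall i, measurable (B i)) ->
  borel_lebesgue n [set v : borel_rV n | forall i, B i (v 0 i)] =
    (\prod_(i < n) @lebesgue_measure R (B i))%E.
Proof.
elim: n B => [|n IHn] B mB.
  by rewrite big_ord0 /= diracE mem_set// => -[].
rewrite big_ord_recl -IHn// -product_measure1E; first last.
- by apply: (@measurable_rect n (fun i => B (lift ord0 i))) => i.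
- exact: mB.
apply: (congr1 (@lebesgue_measure R \x borel_lebesgue n)%E).
apply/seteqP; split => -[x v] /=.
  move=> h; split=> [|i]; first by rewrite -(rVcons0 x v); exact: h.
  by rewrite -(rVconsS x v); exact: h.
move=> [Bx Bv] i; case: (unliftP ord0 i) => [j ->|->].
  by rewrite rVconsS; exact: Bv.
by rewrite rVcons0.
Qed.

(* The Lebesgue sigma-algebra is taken as the Caratheodory-measurable sets of
   the outer measure induced by [borel_lebesgue]. *)
Definition lebesgue_rV (n : nat) : measurableType _ :=
  caratheodory_type ((borel_lebesgue n)^*)%mu.

Definition lebesgue (n : nat) : {measure set (lebesgue_rV n) -> \bar R} :=
  @completed_measure_extension _ _ _ (borel_lebesgue n).

Lemma lebesgueE (n : nat) (A : set (borel_rV n)) :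
  measurable A -> lebesgue n A = borel_lebesgue n A.
Proof. exact: measurable_mu_extE. Qed.

Definition Linfty (n : nat) (phi : 'rV[R]_n -> R) : Prop :=
  (phi : lebesgue_rV n -> R) \in Lfun (lebesgue n) +oo%E.

(* The norm of the library on ['rV[R]_n] is the sup norm. *)
Definition sqdist (n : nat) (x y : 'rV[R]_n) : R :=
  \sum_(i < n) (x 0 i - y 0 i) ^+ 2.

Definition heat (n : nat) (t : R) (phi : 'rV[R]_n -> R) (x : 'rV[R]_n) : R :=
  (4 * pi * t) `^ (- (n%:R / 2)) *
  \int[lebesgue n]_(y in setT) (expR (- sqdist x y / (4 * t)) * phi y).

(* [a] may be [+oo]. *)
Definition itv0 (a : \bar R) : set R := [set r | 0 <= r /\ (r%:E < a)%E].

(* [F] is a total function, of which only the restriction to [itv0 a] matters;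
   continuity at the points of the open set (0, a) does not depend on the values
   outside. *)
Definition admissible (a : \bar R) (F : R -> \bar R) : Prop :=
  [/\ (forall r, itv0 a r -> F r != +oo%E),
      (forall r : R, 0 < r -> (r%:E < a)%E -> {for r, continuous F}),
      (forall r s, itv0 a r -> itv0 a s -> r < s -> (F r < F s)%E) &
      F 0 = -oo%E].

(* In the library, -oo + b = -oo for every b, and k%:E * -oo = -oo for 0 < k. *)
Definition F_concave (a : \bar R) (F : R -> \bar R) (n : nat)
    (f : 'rV[R]_n -> R) : Prop :=
  (forall x, itv0 a (f x)) /\
  forall (x y : 'rV[R]_n) (l : R), 0 < l < 1 ->
    ((1 - l)%:E * F (f x) + l%:E * F (f y)
      <= F (f ((1 - l) *: x + l *: y)%R))%E.

Definition log_concave (n : nat) (f : 'rV[R]_n -> R) : Prop :=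
  forall (x y : 'rV[R]_n) (l : R), 0 < l < 1 ->
    f x `^ (1 - l) * f y `^ l <= f ((1 - l) *: x + l *: y).

Definition quasi_concave (n : nat) (f : 'rV[R]_n -> R) : Prop :=
  forall (x y : 'rV[R]_n) (l : R), 0 < l < 1 ->
    Num.min (f x) (f y) <= f ((1 - l) *: x + l *: y).

End Euclidean.

(* Main.v *)
(* Failure of log-concavity gives r1, r2 in (0, a) for which log o F^-1 violates
   concavity on the segment between F r1 and F r2. Let h(s) = F^-1 (min (s, F (max (r1, r2))))
   for s at least some number slightly below F (min (r1, r2)), and h(s) = 0 otherwise,
   and let phi (v) = h (v_0) when all other coordinates are in [-1, 0], phi (v) = 0
   elsewhere. Then F o phi is concave, and the heat flow acts on each coordinate
   separately. As t -> 0 the factor coming from h tends to h at its continuity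
   points, so it still violates log-concavity at three points p, z, q. In the
   direction of v_1, far outside of the cube, the factor is nearly log-affine with any
   prescribed slope along a short segment; choosing the slope that balances the
   values at p and q makes the product smaller at z than at both endpoints. *)

Require Import Defs.
From mathcomp Require Import all_boot all_order all_algebra.
From mathcomp Require Import all_classical all_reals all_analysis.
From mathcomp Require Import measurable_realfun ess_sup_inf.
From mathcomp Require Import ring lra.

Set Implicit Arguments.
Unset Strict Implicit.
Unset Printing Implicit Defensive.

Import Order.TTheory GRing.Theory Num.Theory.
Import numFieldNormedType.Exports.

Local Open Scope classical_set_scope.
Local Open Scope ring_scope.

(** * Integrals over R^n of products of one-variable functions *)

Section product_integral.
Context (R : realType).

Lemma measurable_id_lebesgue_rV (n : nat) :
  measurable_fun setT (id : lebesgue_rV R n -> borel_rV R n).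
Proof.
move=> _ A mA; rewrite setTI.
by apply: sub_caratheodory; exact: sub_sigma_algebra.
Qed.

(** Change of variables along the identity, from the completed space to the Borel one; the two
    measures agree on Borel sets. This gives access to the product structure of [borel_lebesgue]. *)
Lemma integral_lebesgue_rV (n : nat) (f : borel_rV R n -> R) :
  measurable_fun setT f -> (forall v, 0 <= f v) ->
  (\int[lebesgue R n]_(v in setT) (f v)%:E =
   \int[borel_lebesgue R n]_(v in setT) (f v)%:E)%E.
Proof.
move=> mf f0.
have mid := @measurable_id_lebesgue_rV n.
have /(_ setT (EFin \o f)) := ge0_integral_pushforward mid (lebesgue R n).
rewrite preimage_id => <- //; last 2 first.
- exact/measurable_EFinP.
- by move=> v _; rewrite lee_fin.
by apply: eq_measure_integral => A mA _; exact: lebesgueE.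
Qed.

Lemma measurable_fun_prod_coord (n : nat) (f : 'I_n -> R -> R) :
  (forall i, measurable_fun setT (f i)) ->
  measurable_fun setT (fun v : borel_rV R n => \prod_(i < n) f i (v 0 i)).
Proof.
move=> mf.
apply: measurable_prod => i _.
by apply: measurableT_comp => //; exact: measurable_coord.
Qed.

(** Induction on [n]: [lebesgue_step] is a product measure transported by [rVcons], so Tonelli
    splits off coordinate 0. *)
Lemma integral_borel_prod (n : nat) (f : 'I_n -> R -> R) :
  (forall i, measurable_fun setT (f i)) -> (forall i x, 0 <= f i x) ->
  (\int[borel_lebesgue R n]_(v in setT) (\prod_(i < n) f i (v 0 i))%:E =
   \prod_(i < n) \int[@lebesgue_measure R]_x (f i x)%:E)%E.
Proof.
elim: n f => [|n IHn] f mf f0.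
  rewrite big_ord0 /=.
  under eq_integral do rewrite big_ord0.
  by rewrite integral_cst //= mul1e diracT.
rewrite big_ord_recl -IHn//.
have mP : measurable_fun setT (fun v : borel_rV R n =>
    \prod_(i < n) f (lift ord0 i) (v 0 i)).
  exact: (measurable_fun_prod_coord (f := fun i => f (lift ord0 i))).
rewrite /= /lebesgue_step ge0_integral_pushforward//=; first last.
- by move=> v _; rewrite lee_fin prodr_ge0.
- by apply/measurable_EFinP; exact: measurable_fun_prod_coord.
- exact: measurable_rVcons.
rewrite preimage_setT.
pose g (v : borel_rV R n) := \prod_(i < n) f (lift ord0 i) (v 0 i).
have g0 v : 0 <= g v by exact: prodr_ge0.
rewrite (eq_integral (fun p : measurableTypeR R * borel_rV R n =>
    (f ord0 p.1 * g p.2)%:E)); last first.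
  move=> [x v] _; rewrite /= big_ord_recl rVcons0; congr (_ * _)%:E.
  by apply: eq_bigr => i _; rewrite rVconsS.
rewrite fubini_tonelli1/=; first last.
- by move=> p; rewrite lee_fin mulr_ge0.
- apply/measurable_EFinP/measurable_funM.
    exact: (measurableT_comp (mf ord0) measurable_fst).
  exact: (measurableT_comp mP measurable_snd).
rewrite /fubini_F/=.
under eq_integral.
  move=> x _; under eq_integral do rewrite EFinM.
  rewrite ge0_integralZl//; last 3 first.
  - exact/measurable_EFinP.
  - by move=> v _; rewrite lee_fin.
  - by rewrite lee_fin.
  over.
rewrite ge0_integralZr//.
- by move/measurable_EFinP: (mf ord0).
- by move=> x _; rewrite lee_fin.
- by apply: integral_ge0 => v _; rewrite lee_fin.
Qed.
End product_integral.

(** * The heat flow of a product as a product of one-dimensional Gaussian convolutions *)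

Section heat_product.
Context (R : realType).
Implicit Types (t x y M : R) (g : R -> R).

(** The heat kernel without normalisation: its mass [Num.sqrt (4 * pi * t)] is carried explicitly
    through the estimates. *)
Definition gauss t x y := expR (- (x - y) ^+ 2 / (4 * t)).

Definition gauss_conv t g x : R :=
  \int[@lebesgue_measure R]_(y in setT) (gauss t x y * g y).

Lemma measurable_gauss t x : measurable_fun setT (gauss t x).
Proof.
apply: measurableT_comp => //; apply: measurable_funM => //.
apply: measurableT_comp => //; apply: measurable_funX.
exact: measurable_funB.
Qed.

Lemma measurable_EFin_comp (f : R -> R) : measurable_fun setT f ->
  measurable_fun [set: measurableTypeR R] (fun x => (f x)%:E).
Proof. by move/measurable_EFinP. Qed.

(** Up to the factor [Num.sqrt (4 * pi * t)], the kernel is the normal density of mean [x] and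
    variance [2 * t]. *)
Lemma integral_gauss t x : 0 < t ->
  (\int[@lebesgue_measure R]_(y in setT) (gauss t x y)%:E =
   (Num.sqrt (4 * pi * t))%:E)%E.
Proof.
move=> t0; pose s : R := Num.sqrt (2 * t).
have ss : s ^+ 2 = 2 * t by rewrite sqr_sqrtr// mulr_ge0// ltW.
have s0 : s != 0 by rewrite gt_eqF// sqrtr_gt0 mulr_gt0.
have c0 : 0 < Num.sqrt (4 * pi * t) by rewrite sqrtr_gt0 !mulr_gt0// pi_gt0.
have peakE : normal_peak s = (Num.sqrt (4 * pi * t))^-1.
  by rewrite /normal_peak ss; congr (Num.sqrt _)^-1; ring.
have gE y : gauss t x y = Num.sqrt (4 * pi * t) * normal_pdf x s y.
  rewrite normal_pdfE// peakE mulrA divff ?gt_eqF// mul1r /normal_fun ss.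
  by congr expR; rewrite -[x - y]opprB sqrrN; congr (_ / _); ring.
under eq_integral do rewrite gE EFinM.
rewrite ge0_integralZl//; last 2 first.
- by apply: measurable_EFin_comp; exact: measurable_normal_pdf.
- by move=> y _; rewrite lee_fin normal_pdf_ge0.
by rewrite integral_normal_pdf mule1.
Qed.

Definition bounded_nneg M g :=
  measurable_fun setT g /\ forall y, 0 <= g y <= M.

(** Domination by [M] times the kernel makes the integral finite, so nothing is lost in passing to
    the real-valued integral. *)
Lemma gauss_convE t M g x : 0 < t -> bounded_nneg M g ->
  (\int[@lebesgue_measure R]_(y in setT) (gauss t x y * g y)%:E =
   (gauss_conv t g x)%:E)%E.
Proof.
move=> t0 [mg gb]; have g0 y : 0 <= g y by have /andP[] := gb y.
have M0 : 0 <= M by apply: (le_trans (g0 0)); have /andP[] := gb 0.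
have i0 : (0 <= \int[@lebesgue_measure R]_(y in setT) (gauss t x y * g y)%:E)%E.
  by apply: integral_ge0 => y _; rewrite lee_fin mulr_ge0// expR_ge0.
rewrite /gauss_conv /Rintegral fineK// ge0_fin_numE//.
apply: (@le_lt_trans _ _
    (\int[@lebesgue_measure R]_(y in setT) (M%:E * (gauss t x y)%:E))%E).
  apply: ge0_le_integral => //.
  - by move=> y _; rewrite lee_fin mulr_ge0// expR_ge0.
  - by apply: measurable_EFin_comp; apply: measurable_funM => //; exact: measurable_gauss.
  - apply: measurable_EFin_comp; apply: measurable_funM => //; exact: measurable_gauss.
  - move=> y _; rewrite lee_fin mulrC ler_wpM2r// ?expR_ge0//.
    by have /andP[] := gb y.
rewrite ge0_integralZl//; last 2 first.
- by apply: measurable_EFin_comp; exact: measurable_gauss.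
- by move=> y _; rewrite lee_fin expR_ge0.
by rewrite integral_gauss// -EFinM ltry.
Qed.

Lemma measurable_gauss_mul t x M g : bounded_nneg M g ->
  measurable_fun setT (fun y => gauss t x y * g y).
Proof.
by move=> [mg _]; apply: measurable_funM => //; exact: measurable_gauss.
Qed.

Lemma gauss_mul_ge0 t x M g y : bounded_nneg M g -> 0 <= gauss t x y * g y.
Proof.
by move=> [_ gb]; rewrite mulr_ge0 ?expR_ge0//; have /andP[] := gb y.
Qed.

Lemma gauss_conv_ge0 t x M g : bounded_nneg M g -> 0 <= gauss_conv t g x.
Proof.
move=> gb; apply/fine_ge0/integral_ge0 => y _.
by rewrite lee_fin; exact: gauss_mul_ge0 gb.
Qed.

(** Common tool for the estimates below. The two terms on the right allow for a main term and a tail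
    term at time [2 * t]; estimates without a tail take [a3 = 0]. *)
Lemma le_gauss_conv a1 a2 a3 t1 t2 t3 x1 x2 x3 M1 M2 M3 g1 g2 g3 :
  0 <= a1 -> 0 <= a2 -> 0 <= a3 -> 0 < t1 -> 0 < t2 -> 0 < t3 ->
  bounded_nneg M1 g1 -> bounded_nneg M2 g2 -> bounded_nneg M3 g3 ->
  (forall y, a1 * (gauss t1 x1 y * g1 y) <=
     a2 * (gauss t2 x2 y * g2 y) + a3 * (gauss t3 x3 y * g3 y)) ->
  a1 * gauss_conv t1 g1 x1 <=
    a2 * gauss_conv t2 g2 x2 + a3 * gauss_conv t3 g3 x3.
Proof.
move=> a10 a20 a30 t10 t20 t30 b1 b2 b3 le123.
have scale a t x M g : 0 <= a -> 0 < t -> bounded_nneg M g ->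
    (\int[@lebesgue_measure R]_(y in setT) (a * (gauss t x y * g y))%:E =
     (a * gauss_conv t g x)%:E)%E.
  move=> a0 t0 gb; under eq_integral do rewrite EFinM.
  rewrite ge0_integralZl//; last 2 first.
  - by apply: measurable_EFin_comp; exact: measurable_gauss_mul gb.
  - by move=> y _; rewrite lee_fin; exact: gauss_mul_ge0 gb.
  by rewrite (gauss_convE _ t0 gb) EFinM.
have mscale a t x M g : bounded_nneg M g ->
    measurable_fun [set: measurableTypeR R]
      (fun y => (a * (gauss t x y * g y))%:E).
  move=> gb; apply: measurable_EFin_comp; apply: measurable_funM => //.
  exact: measurable_gauss_mul gb.
have scale0 a t x M g y : 0 <= a -> bounded_nneg M g ->
    (0 <= (a * (gauss t x y * g y))%:E)%E.
  by move=> a0 gb; rewrite lee_fin mulr_ge0//; exact: gauss_mul_ge0 gb.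
rewrite -lee_fin EFinD -(scale _ _ _ _ _ a10 t10 b1).
rewrite -(scale _ _ _ _ _ a20 t20 b2) -(scale _ _ _ _ _ a30 t30 b3).
rewrite -ge0_integralD//; first last.
- exact: mscale b3.
- by move=> y _; exact: scale0 b3.
- exact: mscale b2.
- by move=> y _; exact: scale0 b2.
apply: ge0_le_integral => //.
- by move=> y _; exact: scale0 b1.
- exact: mscale b1.
- apply: emeasurable_funD; [exact: mscale b2|exact: mscale b3].
- by move=> y _; rewrite -EFinD lee_fin.
Qed.

Lemma gauss_conv1 t x : 0 < t ->
  gauss_conv t (fun=> 1) x = Num.sqrt (4 * pi * t).
Proof.
move=> t0; rewrite /gauss_conv /Rintegral.
by under eq_integral do rewrite mulr1; rewrite integral_gauss.
Qed.

(** [expR] turns the sum [sqdist] into a product over the coordinates, to which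
    [integral_borel_prod] applies. *)
Lemma heat_prod n t M (g : 'I_n -> R -> R) (x : 'rV[R]_n) : 0 < t ->
  (forall i, bounded_nneg M (g i)) ->
  heat t (fun y : 'rV[R]_n => \prod_(i < n) g i (y 0 i)) x =
  (4 * pi * t) `^ (- (n%:R / 2)) * \prod_(i < n) gauss_conv t (g i) (x 0 i).
Proof.
move=> t0 gb; rewrite /heat; congr (_ * _).
rewrite /Rintegral.
under eq_integral => y _.
  rewrite /sqdist mulNr mulr_suml -sumrN expR_sum -big_split/=.
  under eq_bigr do rewrite -mulNr.
  over.
rewrite /=.
rewrite (integral_lebesgue_rV
  (f := fun y : borel_rV R n => \prod_(i < n) (gauss t (x 0 i) (y 0 i) * g i (y 0 i)))); first last.
- move=> v; apply: prodr_ge0 => i _; rewrite mulr_ge0 ?expR_ge0//.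
  by have /andP[] := (gb i).2 (v 0 i).
- apply: (measurable_fun_prod_coord (f := fun i y => gauss t (x 0 i) y * g i y)).
  move=> i; apply: measurable_funM; first exact: measurable_gauss.
  exact: (gb i).1.
rewrite (integral_borel_prod (f := fun i y => gauss t (x 0 i) y * g i y)).
- rewrite (eq_bigr _ (fun i _ => gauss_convE (x 0 i) t0 (gb i))).
  by rewrite prodEFin.
- move=> i; apply: measurable_funM; first exact: measurable_gauss.
  exact: (gb i).1.
- move=> i y; rewrite mulr_ge0 ?expR_ge0//.
  by have /andP[] := (gb i).2 y.
Qed.
End heat_product.

(** * Small-time limits and translation bounds for Gaussian convolutions *)

Section gauss_estimates.
Context (R : realType).
Implicit Types (t x y M : R) (g : R -> R).

(** Half of the exponent is kept as the kernel at time [2 * t]. The other half contributes at most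
    exp(-u) with u = eta^2/(8t), which is at most 1/u because u <= 1 + u <= exp(u). The bound is
    linear in [t] and still integrable in [y]. *)
Lemma gauss_tail t eta x y : 0 < t -> 0 < eta -> eta <= `|x - y| ->
  gauss t x y <= 8 * t / eta ^+ 2 * gauss (2 * t) x y.
Proof.
move=> t0 eta0 hxy.
have h2 : eta ^+ 2 <= (x - y) ^+ 2.
  by rewrite -(real_normK (num_real (x - y))) ler_pXn2r// ?nnegrE ?ltW.
have u0 : 0 < eta ^+ 2 / (8 * t) by rewrite divr_gt0 ?exprn_gt0 ?mulr_gt0.
apply: (@le_trans _ _ (expR (- (eta ^+ 2 / (8 * t))) * gauss (2 * t) x y)).
  rewrite /gauss -expRD ler_expR -subr_ge0.
  rewrite (_ : _ - _ = ((x - y) ^+ 2 - eta ^+ 2) / (8 * t)); last first.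
    by field; rewrite gt_eqF.
  by rewrite divr_ge0 ?subr_ge0// mulr_ge0// ltW.
rewrite ler_wpM2r ?expR_ge0// expRN -[leRHS]invf_div lef_pV2 ?posrE ?expR_gt0//.
by apply: le_trans (expR_ge1Dx _); rewrite lerDr.
Qed.

Lemma sqrt_mass_double t : 0 < t ->
  Num.sqrt (4 * pi * (2 * t)) <= 2 * Num.sqrt (4 * pi * t) :> R.
Proof.
move=> t0; have p0 := pi_gt0 R.
have -> : 2 * Num.sqrt (4 * pi * t) = Num.sqrt (4 * (4 * pi * t)) :> R.
  rewrite [RHS]sqrtrM//; congr (_ * _).
  by rewrite (_ : 4 = 2 ^+ 2) ?sqrtr_sqr ?ger0_norm//; ring.
rewrite ler_sqrt; last by rewrite !mulr_ge0// ltW.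
have : 0 < pi * t by rewrite mulr_gt0.
by lra.
Qed.

Lemma bounded_nneg_cst (c : R) : 0 <= c -> bounded_nneg c (fun=> c).
Proof. by move=> c0; split=> // y; rewrite c0 lexx. Qed.

(** Within distance [eta] of [x] the function is at most [m]; elsewhere [gauss_tail] applies, and
    [sqrt_mass_double] turns its 8 into 16. *)
Lemma gauss_conv_le t eta g M m x : 0 < t -> 0 < eta -> bounded_nneg M g ->
  0 <= m -> (forall y, `|x - y| < eta -> g y <= m) ->
  gauss_conv t g x <= (m + 16 * M / eta ^+ 2 * t) * Num.sqrt (4 * pi * t).
Proof.
move=> t0 eta0 gb m0 gm.
have M0 : 0 <= M by have /andP[g0] := gb.2 0; exact: le_trans.
have b1 := bounded_nneg_cst (@ler01 R).
have k0 : 0 <= M * (8 * t / eta ^+ 2).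
  by rewrite mulr_ge0// divr_ge0 ?sqr_ge0// mulr_ge0// ltW.
have t20 : 0 < 2 * t by rewrite mulr_gt0.
have := @le_gauss_conv R 1 m (M * (8 * t / eta ^+ 2)) t t (2 * t) x x x
  _ _ _ _ _ _ ler01 m0 k0 t0 t0 t20 gb b1 b1.
rewrite !gauss_conv1// !mul1r => /(_ _)/le_trans; apply => [y|].
  rewrite !mulr1 mul1r; have [hy|hy] := ltP `|x - y| eta.
    rewrite -[leLHS]addr0 lerD// ?(mulr_ge0 k0) ?expR_ge0//.
    by rewrite mulrC ler_wpM2r ?expR_ge0// gm.
  rewrite -[leLHS]add0r lerD// ?(mulr_ge0 m0) ?expR_ge0//.
  rewrite -[leRHS]mulrA mulrC; apply: ler_pM; rewrite ?expR_ge0//.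
  - by have /andP[] := gb.2 y.
  - by have /andP[] := gb.2 y.
  - exact: gauss_tail.
rewrite [leRHS]mulrDl lerD2l.
apply: (le_trans (ler_wpM2l k0 (sqrt_mass_double t0))).
by rewrite le_eqVlt; apply/orP; left; apply/eqP; field; rewrite gt_eqF.
Qed.

(** [m] times the kernel lies below the integrand near [x] and below the tail term elsewhere. *)
Lemma gauss_conv_ge t eta g M m x : 0 < t -> 0 < eta -> bounded_nneg M g ->
  0 <= m -> (forall y, `|x - y| < eta -> m <= g y) ->
  (m - 16 * m / eta ^+ 2 * t) * Num.sqrt (4 * pi * t) <= gauss_conv t g x.
Proof.
move=> t0 eta0 gb m0 gm.
have b1 := bounded_nneg_cst (@ler01 R).
have k0 : 0 <= m * (8 * t / eta ^+ 2).
  by rewrite mulr_ge0// divr_ge0 ?sqr_ge0// mulr_ge0// ltW.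
have t20 : 0 < 2 * t by rewrite mulr_gt0.
have := @le_gauss_conv R m 1 (m * (8 * t / eta ^+ 2)) t t (2 * t) x x x
  _ _ _ _ _ _ m0 ler01 k0 t0 t0 t20 b1 gb b1.
rewrite !gauss_conv1// !mul1r mulrBl lerBlDr => /(_ _)/le_trans; apply => [y|].
  rewrite !mulr1 !mul1r; have [hy|hy] := ltP `|x - y| eta.
    rewrite -[leLHS]addr0 lerD// ?(mulr_ge0 k0) ?expR_ge0//.
    by rewrite mulrC ler_wpM2l ?expR_ge0// gm.
  rewrite -[leLHS]add0r lerD//; first exact: gauss_mul_ge0 gb.
  by rewrite -mulrA ler_wpM2l// gauss_tail.
rewrite lerD2l.
apply: (le_trans (ler_wpM2l k0 (sqrt_mass_double t0))).
by rewrite le_eqVlt; apply/orP; left; apply/eqP; field; rewrite gt_eqF.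
Qed.

Lemma near_right_affine_lt (a b c : R) : a < c ->
  \forall t \near 0^'+, a + b * t < c.
Proof.
move=> ac; have : (fun t => a + b * t) @ 0^'+ --> a.
  apply: cvg_at_right_filter.
  rewrite -[X in _ --> X]addr0 -[X in _ --> _ + X](mulr0 b).
  by apply: cvgD; [exact: cvg_cst|apply: cvgM; [exact: cvg_cst|exact: cvg_id]].
by move/cvgr_lt; apply.
Qed.

Lemma gauss_conv_lt_near g M x c : bounded_nneg M g -> {for x, continuous g} ->
  g x < c ->
  \forall t \near 0^'+, gauss_conv t g x < c * Num.sqrt (4 * pi * t).
Proof.
(* The midpoint leaves room for an error linear in [t]. *)
move=> gb gx gc; pose m := (g x + c) / 2.
have [gm mc] : g x < m /\ m < c by rewrite /m; split; lra.
have m0 : 0 <= m by have /andP[g0 _] := gb.2 x; rewrite ltW// (le_lt_trans g0).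
have /nbhs_ballP[eta /= eta0 hm] : \forall y \near x, g y < m.
  exact: cvgr_lt gx _ gm.
near=> t.
have t0 : 0 < t by near: t; exact: nbhs_right_gt.
apply: (@le_lt_trans _ _
    ((m + 16 * M / eta ^+ 2 * t) * Num.sqrt (4 * pi * t))).
  by apply: gauss_conv_le gb m0 _ => // y xy; apply/ltW/hm.
rewrite ltr_pM2r ?sqrtr_gt0 ?mulr_gt0 ?pi_gt0//.
by near: t; exact: near_right_affine_lt.
Unshelve. all: by end_near. Qed.

Lemma gauss_conv_gt_near g M x c : bounded_nneg M g -> {for x, continuous g} ->
  0 <= c -> c < g x ->
  \forall t \near 0^'+, c * Num.sqrt (4 * pi * t) < gauss_conv t g x.
Proof.
move=> gb gx c0 cg; pose m := (g x + c) / 2.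
have [cm mg] : c < m /\ m < g x by rewrite /m; split; lra.
have m0 : 0 <= m by rewrite ltW// (le_lt_trans c0).
have /nbhs_ballP[eta /= eta0 hm] : \forall y \near x, m < g y.
  exact: cvgr_gt gx _ mg.
near=> t.
have t0 : 0 < t by near: t; exact: nbhs_right_gt.
apply: (@lt_le_trans _ _
    ((m - 16 * m / eta ^+ 2 * t) * Num.sqrt (4 * pi * t))); last first.
  by apply: gauss_conv_ge gb m0 _ => // y xy; apply/ltW/hm.
rewrite ltr_pM2r ?sqrtr_gt0 ?mulr_gt0 ?pi_gt0//.
have : - m + 16 * m / eta ^+ 2 * t < - c.
  by near: t; apply: near_right_affine_lt; rewrite ltrN2.
by lra.
Unshelve. all: by end_near. Qed.

Lemma bounded_nneg_indic (A : set R) : measurable A ->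
  bounded_nneg 1 (\1_A : R -> R).
Proof.
move=> mA; split; first exact: measurable_indic.
by move=> y; rewrite indicE; case: (_ \in _); rewrite ?lexx ?ler01.
Qed.

(** On [-1, 0] the kernel is at least the positive constant [m], because |x - y| <= |x| + 1
    there. *)
Lemma gauss_conv_indic_gt0 t x : 0 < t ->
  0 < gauss_conv t \1_`[-1, 0] x.
Proof.
move=> t0; pose m := expR (- (`|x| + 1) ^+ 2 / (4 * t)).
have b1 := @bounded_nneg_indic `[-1, 0] (measurable_itv _).
rewrite -lte_fin -(gauss_convE x t0 b1).
apply: (@lt_le_trans _ _
    (\int[@lebesgue_measure R]_(y in setT) (m%:E * (\1_`[-1, 0] y)%:E))%E).
  rewrite ge0_integralZl//; last 2 first.
  - exact: (measurable_EFin_comp b1.1).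
  - by rewrite lee_fin expR_ge0.
  rewrite integral_indic// setIT.
  have /= -> := @lebesgue_measure_itv R `[-1, 0].
  by rewrite lte_fin ltrN10 -EFinD add0r opprK mule1 lte_fin expR_gt0.
apply: ge0_le_integral => //.
- by move=> y _; rewrite -EFinM lee_fin mulr_ge0 ?expR_ge0//; have /andP[] := b1.2 y.
- by apply: measurable_EFin_comp; apply: measurable_funM => //; exact: b1.1.
- by apply: measurable_EFin_comp; exact: measurable_gauss_mul b1.
move=> y _; rewrite -EFinM lee_fin indicE.
have [|_] := boolP (y \in _); last by rewrite !mulr0.
rewrite inE/= in_itv/= => /andP[y1 y0]; rewrite !mulr1 ler_expR.
rewrite !mulNr lerN2 ler_wpM2r ?invr_ge0 ?mulr_ge0 ?(ltW t0)//.
rewrite -(real_normK (num_real (x - y))) ler_pXn2r ?nnegrE ?addr_ge0//.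
by rewrite (le_trans (ler_normB _ _))// lerD2l ler_norml; lra.
Qed.

(** The ratio of the kernels at [x + s] and [x] is exp(-(2s(x - y) + s^2)/(4t)), and |s y| <= |s|
    for y in [-1, 0]. For large [x] the term -s x/(2t) dominates. *)
Lemma gauss_conv_indic_le t x s : 0 < t ->
  gauss_conv t \1_`[-1, 0] (x + s) <=
  expR ((`|s| - s * x) / (2 * t)) * gauss_conv t \1_`[-1, 0] x.
Proof.
move=> t0; have b1 := @bounded_nneg_indic `[-1, 0] (measurable_itv _).
have := @le_gauss_conv R 1 (expR ((`|s| - s * x) / (2 * t))) 0 t t t (x + s) x x
  _ _ _ _ _ _ ler01 (expR_ge0 _) (lexx _) t0 t0 t0 b1 b1 b1.
rewrite mul1r mul0r addr0; apply => y; rewrite mul1r mul0r addr0 mulrA indicE.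
have [|_] := boolP (y \in _); last by rewrite !mulr0.
rewrite inE/= in_itv/= => /andP[y1 y0]; rewrite !mulr1 -expRD ler_expR -subr_ge0.
rewrite (_ : _ - _ = (2 * (`|s| + - (s * y)) + s ^+ 2) / (4 * t)); last first.
  by field; rewrite gt_eqF.
rewrite divr_ge0 ?mulr_ge0 ?(ltW t0)// addr_ge0 ?sqr_ge0// mulr_ge0//.
rewrite subr_ge0 (le_trans (ler_norm _))// normrM ler_piMr//.
by rewrite ler_norml; lra.
Qed.

(** The same kernel ratio bounded from below; here the term s^2 has to be kept. *)
Lemma gauss_conv_indic_ge t x s : 0 < t ->
  expR (- (s * x + `|s| + s ^+ 2 / 2) / (2 * t)) * gauss_conv t \1_`[-1, 0] x <=
  gauss_conv t \1_`[-1, 0] (x + s).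
Proof.
move=> t0; have b1 := @bounded_nneg_indic `[-1, 0] (measurable_itv _).
have := @le_gauss_conv R (expR (- (s * x + `|s| + s ^+ 2 / 2) / (2 * t))) 1 0
  t t t x (x + s) x _ _ _ _ _ _ (expR_ge0 _) ler01 (lexx _) t0 t0 t0 b1 b1 b1.
rewrite mul1r mul0r addr0; apply => y; rewrite mul1r mul0r addr0 mulrA indicE.
have [|_] := boolP (y \in _); last by rewrite !mulr0.
rewrite inE/= in_itv/= => /andP[y1 y0]; rewrite !mulr1 -expRD ler_expR -subr_ge0.
rewrite (_ : _ - _ = (`|s| - - (s * y)) / (2 * t)); last first.
  by field; rewrite gt_eqF.
rewrite divr_ge0 ?mulr_ge0 ?(ltW t0)// subr_ge0 (le_trans (ler_norm _))//.
by rewrite normrN normrM ler_piMr// ler_norml; lra.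
Qed.

End gauss_estimates.

(** * Failure of quasi-concavity for a profile multiplied by a cube *)

Section product_with_cube.
Context (R : realType).
Implicit Types (t x y M : R) (g : R -> R).

Let box : R -> R := \1_`[-1, 0].

(** Here [a], [b], [c] stand for the logarithms of the profile at p, q, z, [S] for the kernel mass,
    and [B], [B1], [Bl] for the second factor at the start, at the end and in between. Both endpoint
    products are at least exp(a - 2d) S B, the middle one is below exp(c + 2d - l(b - a)) S B, and
    the gap has room for the four errors [d]. *)
Lemma lt_min_of_log_gap (a b c d l S P Q Z B B1 Bl : R) :
  0 < d -> c + 4 * d < (1 - l) * a + l * b -> 0 < S -> 0 < B -> 0 <= Z ->
  expR (a - d) * S < P -> expR (b - d) * S < Q -> Z < expR (c + d) * S ->
  expR (- (b - a) - d) * B <= B1 -> Bl <= expR (d - l * (b - a)) * B ->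
  Z * Bl < Num.min (P * B) (Q * B1).
Proof.
move=> d0 gap S0 B0 Z0 hP hQ hZ hB1 hBl.
have SB : 0 < S * B by rewrite mulr_gt0.
apply: (@lt_le_trans _ _ (expR (a - 2 * d) * (S * B))).
  apply: (@lt_trans _ _ (expR (c + d) * S * (expR (d - l * (b - a)) * B))).
    apply: (@le_lt_trans _ _ (Z * (expR (d - l * (b - a)) * B))).
      exact: ler_wpM2l.
    by rewrite ltr_pM2r// mulr_gt0// expR_gt0.
  rewrite mulrACA -expRD ltr_pM2r// ltr_expR.
  by lra.
rewrite le_min; apply/andP; split.
  rewrite mulrA ler_pM2r//; apply: le_trans (ltW hP).
  by rewrite ler_pM2r// ler_expR; lra.
apply: (@le_trans _ _ (expR (b - d) * S * (expR (- (b - a) - d) * B))).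
  by rewrite mulrACA -expRD ler_pM2r// ler_expR; lra.
apply: ler_pM => //; last exact: ltW.
- by rewrite mulr_ge0 ?expR_ge0// ltW.
- by rewrite mulr_ge0 ?expR_ge0// ltW.
Qed.

(* Far out, a Gaussian average over [-1, 0] is nearly log-affine along a short
   segment [N, N + s], with slope prescribed by [theta]. *)
Lemma gauss_conv_indic_log_affine t l theta e : 0 < t -> 0 < l < 1 -> 0 < e ->
  exists N s, expR (- theta - e) * gauss_conv t box N <= gauss_conv t box (N + s)
    /\ gauss_conv t box (N + l * s) <= expR (e - l * theta) * gauss_conv t box N.
Proof.
move=> t0 /andP[l0 l1] e0.
(* The errors below are at most |theta|/N + t theta^2/N^2, hence at most [k / N] once [N] is at
   least 1; [N] makes this at most [e]. The step [s] solves s N/(2t) = theta, the main term of the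
   logarithmic decrease. *)
pose k := `|theta| + t * theta ^+ 2.
have k0 : 0 <= k by rewrite addr_ge0// mulr_ge0 ?sqr_ge0// ltW.
pose N := 1 + k / e; pose s := 2 * t * theta / N.
have N1 : 1 <= N by rewrite lerDl divr_ge0// ltW.
have N0 : 0 < N by exact: lt_le_trans N1.
have kN : k / N <= e.
  by rewrite ler_pdivrMr// mulrDr mulr1 mulrCA divff ?gt_eqF// mulr1 lerDr ltW.
have sN : s * N = 2 * t * theta by rewrite /s mulfVK// gt_eqF.
have abs_s : `|s| = 2 * t * (`|theta| / N).
  by rewrite /s !normrM normfV (ger0_norm (ltW t0)) (gtr0_norm N0) ger0_norm// !mulrA.
have b0 : 0 <= gauss_conv t box N by rewrite ltW// gauss_conv_indic_gt0.
have N2 : theta ^+ 2 / N ^+ 2 <= theta ^+ 2 / N.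
  by rewrite ler_wpM2l ?sqr_ge0// lef_pV2 ?posrE ?exprn_gt0// ler_eXnr.
exists N, s; split.
  apply: (le_trans _ (gauss_conv_indic_ge N s t0)); rewrite ler_wpM2r// ler_expR.
  rewrite sN abs_s /s -subr_ge0.
  rewrite [leRHS](_ : _ = e - (`|theta| / N + t * (theta ^+ 2 / N ^+ 2))); last first.
    by field; rewrite !gt_eqF.
  rewrite subr_ge0 (le_trans _ kN)// /k mulrDl lerD2l -[leRHS]mulrA.
  by rewrite ler_wpM2l// ltW.
apply: (le_trans (gauss_conv_indic_le N (l * s) t0)); rewrite ler_wpM2r// ler_expR.
rewrite -mulrA sN normrM abs_s (gtr0_norm l0) -subr_ge0.
rewrite [leRHS](_ : _ = e - l * (`|theta| / N)); last by field; rewrite !gt_eqF.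
rewrite subr_ge0 (le_trans _ kN)// (@le_trans _ _ (`|theta| / N))//.
  by rewrite ler_piMl ?divr_ge0 ?(ltW N0)// ltW.
by rewrite ler_wpM2r ?invr_ge0 ?(ltW N0)// lerDl mulr_ge0 ?sqr_ge0// ltW.
Qed.

Definition cube_factor n g (i : 'I_n) : R -> R := if i == 0 :> nat then g else box.

Definition times_cube n g (v : 'rV[R]_n) : R :=
  \prod_(i < n) cube_factor g i (v 0 i).

Let planar (n : nat) x y : 'rV[R]_n :=
  \row_(i < n) (if i == 0 :> nat then x else if i == 1 :> nat then y else 0).

Lemma bounded_cube_factor n M g (i : 'I_n) : 1 <= M -> bounded_nneg M g ->
  bounded_nneg M (cube_factor g i).
Proof.
move=> M1 gb; rewrite /cube_factor; case: ifP => // _.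
have [mb bb] := @bounded_nneg_indic R `[-1, 0] (measurable_itv _).
by split=> // y; have /andP[-> /le_trans->] := bb y.
Qed.

(** Quasi-concavity is tested only on the plane of the first two coordinates. There the other [n]
    factors are evaluated at 0 and merge with the normalisation into one constant. *)
Lemma heat_times_cube n M g t : 0 < t -> bounded_nneg M g ->
  exists2 c, 0 < c & forall x y, heat t (@times_cube n.+2 g) (planar n.+2 x y) =
    c * (gauss_conv t g x * gauss_conv t box y).
Proof.
move=> t0 gb.
(* The common bound has to be at least 1 to cover the indicator factors. *)
have gb1 : bounded_nneg (1 + M) g.
  have [mg bg] := gb; split=> // y.
  by have /andP[-> /le_trans->] := bg y; rewrite ?lerDr.
have M1 : 1 <= 1 + M.
  by have /andP[/le_trans h /h M0] := gb.2 0; rewrite lerDl.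
exists ((4 * pi * t) `^ (- (n.+2%:R / 2)) * \prod_(i < n) gauss_conv t box 0).
  rewrite mulr_gt0 ?powR_gt0 ?mulr_gt0 ?pi_gt0//.
  by apply: prodr_gt0 => i _; exact: gauss_conv_indic_gt0.
move=> x y; rewrite (heat_prod _ t0 (fun i => bounded_cube_factor i M1 gb1)).
rewrite !big_ord_recl !mxE/= -!mulrA; congr (_ * _).
rewrite [RHS]mulrC -!mulrA; congr (_ * (_ * _)).
by apply: eq_bigr => i _; rewrite !mxE.
Qed.

Lemma heat_times_cube_not_quasi_concave n M g (p q l : R) :
  bounded_nneg M g -> 0 < l < 1 -> let z := (1 - l) * p + l * q in
  {for p, continuous g} -> {for q, continuous g} -> {for z, continuous g} ->
  0 < g p -> 0 < g q -> 0 < g z -> g z < g p `^ (1 - l) * g q `^ l ->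
  \forall t \near 0^'+, ~ quasi_concave (heat t (@times_cube n.+2 g)).
Proof.
move=> gb l01 z cp cq cz gp0 gq0 gz0.
have [a ea] : exists a, g p = expR a by exists (ln (g p)); rewrite lnK.
have [b eb] : exists b, g q = expR b by exists (ln (g q)); rewrite lnK.
have [c ec] : exists c, g z = expR c by exists (ln (g z)); rewrite lnK.
rewrite ea eb ec /powR !gt_eqF ?expR_gt0// !expRK -expRD ltr_expR => gap.
(* Any positive [d] below a quarter of the gap would do; it is fixed before [t]. *)
have [d d0 hd] : exists2 d, 0 < d & c + 4 * d < (1 - l) * a + l * b.
  by exists (((1 - l) * a + l * b - c) / 5); lra.
have ltp : expR (a - d) < g p by rewrite ea ltr_expR gtrBl.
have ltq : expR (b - d) < g q by rewrite eb ltr_expR gtrBl.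
have ltz : g z < expR (c + d) by rewrite ec ltr_expR ltrDl.
near=> t.
have t0 : 0 < t by near: t; exact: nbhs_right_gt.
have hp : expR (a - d) * Num.sqrt (4 * pi * t) < gauss_conv t g p.
  by near: t; exact: gauss_conv_gt_near gb cp (expR_ge0 _) ltp.
have hq : expR (b - d) * Num.sqrt (4 * pi * t) < gauss_conv t g q.
  by near: t; exact: gauss_conv_gt_near gb cq (expR_ge0 _) ltq.
have hz : gauss_conv t g z < expR (c + d) * Num.sqrt (4 * pi * t).
  by near: t; exact: gauss_conv_lt_near gb cz ltz.
(* Since [t] is fixed by now, [N] and [s] may depend on it. The slope parameter [b - a] balances the
   values at [p] and [q]. *)
have [N [s [hN hs]]] := gauss_conv_indic_log_affine (b - a) t0 l01 d0.
have [k k0 heatE] := heat_times_cube n t0 gb.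
move=> /(_ (planar n.+2 p N) (planar n.+2 q (N + s)) l l01).
have -> : (1 - l) *: planar n.+2 p N + l *: planar n.+2 q (N + s) =
    planar n.+2 z (N + l * s).
  apply/rowP => i; rewrite !mxE; case: ifP => // _; case: ifP => _; ring.
rewrite !heatE; apply/negP; rewrite -ltNge -minr_pMr ?(ltW k0)// ltr_pM2l//.
apply: lt_min_of_log_gap d0 hd _ _ _ hp hq hz hN hs.
- by rewrite sqrtr_gt0 !mulr_gt0// pi_gt0.
- exact: gauss_conv_indic_gt0.
- exact: gauss_conv_ge0 gb.
Unshelve. all: by end_near. Qed.

End product_with_cube.

(** * A truncated inverse of a continuous increasing function *)

Section truncated_inverse.
Context (R : realType) (G : R -> R) (r0 r2 : R).
Hypotheses (r0_ge0 : 0 <= r0) (r02 : r0 <= r2).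
Hypothesis G_cont : {within `[r0, r2], continuous G}.
Hypothesis G_inc : {in `[r0, r2] &, {homo G : r s / r < s}}.

(* Above [G r2] the value stays at [r2]: in the application this makes
   [F (truncated_inverse s)] equal to [min (s, F r2)], a concave function of [s]. *)
Definition truncated_inverse (s : R) : R :=
  if s < G r0 then 0
  else xget r0 [set r | r \in `[r0, r2] /\ G r = Num.min s (G r2)].

Local Notation h := truncated_inverse.

Let G_mono : {in `[r0, r2] &, {mono G : r s / r <= s}}.
Proof. exact: le_mono_in G_inc. Qed.

Lemma truncated_inverse0 s : s < G r0 -> h s = 0.
Proof. by rewrite /h => ->. Qed.

Let r0_in : r0 \in `[r0, r2]. Proof. by rewrite in_itv/= lexx. Qed.
Let r2_in : r2 \in `[r0, r2]. Proof. by rewrite in_itv/= lexx andbT. Qed.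

(** The target value lies between [G r0] and [G r2], so the intermediate value theorem provides a
    solution and the default of [xget] does not come into play. *)
Lemma truncated_inverseP s : G r0 <= s ->
  h s \in `[r0, r2] /\ G (h s) = Num.min s (G r2).
Proof.
move=> s0; rewrite /h ltNge s0/=.
have G02 : G r0 <= G r2 by rewrite G_mono.
have [|c c_in Gc] := @IVT _ G r0 r2 (Num.min s (G r2)) r02 G_cont.
  by rewrite (min_l G02) (max_r G02) le_min s0 G02 ge_min lexx orbT.
by case: xgetP => [r _ //|/(_ c)[]].
Qed.

Lemma truncated_inverseK r : r \in `[r0, r2] -> h (G r) = r.
Proof.
move=> r_in; have /andP[r0r rr2] : r0 <= r <= r2 by move: r_in; rewrite in_itv.
have [|h_in] := @truncated_inverseP (G r); first by rewrite G_mono.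
rewrite min_l ?G_mono// => Gh.
by apply: le_anti; rewrite -(G_mono h_in r_in) -(G_mono r_in h_in) Gh lexx.
Qed.

(** Serves to prove [h] measurable. The jump at [G r0] goes upwards from 0. *)
Lemma truncated_inverse_nondecreasing : {homo h : s t / s <= t}.
Proof.
move=> s t st; have [s0|s0] := ltP s (G r0).
  rewrite truncated_inverse0//; have [t0|t0] := ltP t (G r0).
    by rewrite truncated_inverse0.
  have [+ _] := truncated_inverseP t0; rewrite in_itv/= => /andP[+ _].
  exact: le_trans.
have [hs Gs] := truncated_inverseP s0.
have [ht Gt] := truncated_inverseP (le_trans s0 st).
by rewrite -G_mono// Gs Gt le_min !ge_min st lexx orbT.
Qed.

Lemma truncated_inverse_bounded : bounded_nneg r2 h.
Proof.
split; first by apply: nondecreasing_measurable => //; exact: truncated_inverse_nondecreasing.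
move=> s; have [s0|s0] := ltP s (G r0).
  by rewrite truncated_inverse0// lexx (le_trans r0_ge0).
have [+ _] := truncated_inverseP s0; rewrite in_itv/= => /andP[? ->].
by rewrite (le_trans r0_ge0).
Qed.

(** The jump at [G r0] is avoided. Each one-sided bound is transported through the strictly
    increasing [G], unless [h s - e] or [h s + e] leaves the interval, where it is immediate. *)
Lemma truncated_inverse_continuous s : G r0 < s -> {for s, continuous h}.
Proof.
move=> s0; have [hs Ghs] := truncated_inverseP (ltW s0).
have /andP[r0h hr2] : r0 <= h s <= r2 by move: hs; rewrite in_itv.
have nbhs_gt c : c < s -> \forall t \near s, c < t.
  exact: (@cvgr_gt _ _ (nbhs s) _ id s (@cvg_id _ _)).
have h_in t : G r0 < t -> r0 <= h t <= r2.
  by move=> /ltW/truncated_inverseP[+ _]; rewrite in_itv.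
apply/cvgrPdist_lt => e e0.
have lo : \forall t \near s, h s - e < h t.
  have [hr0|r0e] := ltP (h s - e) r0.
    near=> t; have /andP[+ _] : r0 <= h t <= r2.
      by apply: h_in; near: t; exact: nbhs_gt.
    exact: lt_le_trans.
  have e_in : h s - e \in `[r0, r2].
    by rewrite in_itv/= r0e (le_trans _ hr2)// gerBl ltW.
  have : G (h s - e) < G (h s) by rewrite (leW_mono_in G_mono)// gtrBl.
  rewrite Ghs lt_min => /andP[es er2]; near=> t.
  have t0 : G r0 < t by near: t; exact: nbhs_gt.
  have [ht Ght] := truncated_inverseP (ltW t0).
  rewrite -(leW_mono_in G_mono)// Ght lt_min er2 andbT.
  by near: t; exact: nbhs_gt.
have hi : \forall t \near s, h t < h s + e.
  have [re|re2] := ltP r2 (h s + e).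
    near=> t; have /andP[_ htr2] : r0 <= h t <= r2.
      by apply: h_in; near: t; exact: nbhs_gt.
    exact: le_lt_trans re.
  have e_in : h s + e \in `[r0, r2].
    by rewrite in_itv/= re2 (le_trans r0h)// lerDl ltW.
  have : G (h s) < G (h s + e) by rewrite (leW_mono_in G_mono)// ltrDl.
  rewrite Ghs gt_min => /orP lt_e.
  have {}lt_e : \forall t \near s, t < G (h s + e) \/ G r2 < G (h s + e).
    case: lt_e => [se|r2e]; last by near=> t; right.
    by near=> t; left; near: t; exact: lt_nbhsl.
  near=> t.
  have t0 : G r0 < t by near: t; exact: nbhs_gt.
  have [ht Ght] := truncated_inverseP (ltW t0).
  rewrite -(leW_mono_in G_mono)// Ght gt_min.
  by apply/orP; near: t; exact: lt_e.
near=> t; rewrite ltr_distlC; apply/andP; split; near: t.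
  exact: lo.
exact: hi.
Unshelve. all: by end_near. Qed.

End truncated_inverse.

(** * Values and essential boundedness of the profile times the cube *)

Section times_cube.
Context (R : realType).

Lemma times_cube_ge0 n M (g : R -> R) (v : 'rV[R]_n) : bounded_nneg M g ->
  0 <= times_cube g v.
Proof.
move=> gb; apply: prodr_ge0 => i _; rewrite /cube_factor.
by case: ifP => _; [have /andP[] := gb.2 (v 0 i)|rewrite indicE].
Qed.

Lemma times_cubeE n (g : R -> R) (v : 'rV[R]_n.+1) :
  (forall i : 'I_n, -1 <= v 0 (lift ord0 i) <= 0) -> times_cube g v = g (v 0 0).
Proof.
move=> hv; rewrite /times_cube big_ord_recl big1 ?mulr1// => i _.
by rewrite /cube_factor/= indicE mem_set//= in_itv hv.
Qed.

Lemma times_cube0 n (g : R -> R) (v : 'rV[R]_n.+1) (i : 'I_n) :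
  ~~ (-1 <= v 0 (lift ord0 i) <= 0) -> times_cube g v = 0.
Proof.
move=> hv; rewrite /times_cube (bigD1 (lift ord0 i))//= .
rewrite [X in X * _](_ : _ = 0) ?mul0r//.
by rewrite /cube_factor/= indicE memNset//= in_itv/=; exact/negP.
Qed.

(** Borel measurability passes to the larger Lebesgue sigma-algebra, and the bound [M] holds at
    every point because the cube factors are 0 or 1. *)
Lemma Linfty_times_cube n M (g : R -> R) : bounded_nneg M g ->
  Linfty (@times_cube R n.+1 g).
Proof.
move=> gb; have M0 : 0 <= M by have /andP[g0] := gb.2 0; exact: le_trans.
have gle (v : 'rV[R]_n.+1) : times_cube g v <= M.
  have [/forallP hv|] := boolP [forall i : 'I_n, -1 <= v 0 (lift ord0 i) <= 0].
    by rewrite times_cubeE//; have /andP[] := gb.2 (v 0 0).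
  by rewrite negb_forall => /existsP[i hi]; rewrite (times_cube0 _ hi).
have mphi : measurable_fun [set: lebesgue_rV R n.+1]
    (times_cube g : lebesgue_rV R n.+1 -> R).
  apply: (measurableT_comp (f := times_cube g : borel_rV R n.+1 -> R)
    _ (@measurable_id_lebesgue_rV R n.+1)).
  apply: (measurable_fun_prod_coord (f := fun i => cube_factor g i)) => i.
  by rewrite /cube_factor; case: ifP => _; [exact: gb.1|exact: measurable_indic].
rewrite /Linfty inE; apply/andP; split; rewrite inE//=.
rewrite /finite_norm unlock; case: ifPn => // _.
apply: le_lt_trans (ltry M); apply/ess_supP/nearW => v /=.
by rewrite lee_fin ger0_norm// (times_cube_ge0 _ gb).
Qed.

End times_cube.

(** * F-concavity of the profile times the cube *)

Section F_concave_profile.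
Context (R : realType) (a : \bar R) (F : R -> \bar R).
Hypothesis hF : admissible a F.

(** Strict monotonicity from [F 0 = -oo] excludes the value -oo at positive points. *)
Lemma admissible_fin_num r : 0 < r -> (r%:E < a)%E -> F r \is a fin_num.
Proof.
have [Fy _ Finc F0] := hF; move=> r0 ra.
have r_in : itv0 a r by split=> //; exact: ltW.
have /Finc/(_ r_in r0) : itv0 a 0.
  by split=> //; apply: lt_trans ra; rewrite lte_fin.
by rewrite F0 fin_numE Fy// andbT => /gt_eqF ->.
Qed.

Section truncated.
Variables (r0 r2 : R).
Hypotheses (r0_gt0 : 0 < r0) (r02 : r0 <= r2) (r2a : (r2%:E < a)%E).

Let G := fine \o F.

Let pos_lt r : r \in `[r0, r2] -> 0 < r /\ (r%:E < a)%E.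
Proof.
rewrite in_itv/= => /andP[r0r rr2]; split; first exact: lt_le_trans r0r.
by apply: le_lt_trans r2a; rewrite lee_fin.
Qed.

Lemma admissible_fineK : {in `[r0, r2], forall r, F r = (G r)%:E}.
Proof. by move=> r /pos_lt[? ?]; rewrite fineK// admissible_fin_num. Qed.

Lemma admissible_fine_inc : {in `[r0, r2] &, {homo G : r s / r < s}}.
Proof.
move=> r s r_in s_in rs; rewrite -lte_fin -!admissible_fineK//.
have [_ _ Finc _] := hF; have [? ?] := pos_lt r_in; have [? ?] := pos_lt s_in.
by apply: Finc => //; split=> //; exact: ltW.
Qed.

Lemma admissible_fine_continuous : {within `[r0, r2], continuous G}.
Proof.
apply: continuous_in_subspaceT => r; rewrite inE => r_in.
have [_ Fcont _ _] := hF; have [rp ra] := pos_lt r_in.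
apply: fine_cvg; rewrite -/(G r) -admissible_fineK//.
exact: Fcont.
Qed.

Local Notation h := (truncated_inverse G r0 r2).

(** On a convex set, F of the function is min(v_0, G r2), a minimum of two affine functions; off
    that set it is -oo. So only endpoints inside the set matter. *)
Lemma F_concave_times_cube n : F_concave a F (@times_cube R n.+1 h).
Proof.
have P := truncated_inverseP r02 admissible_fine_continuous admissible_fine_inc.
have gb := truncated_inverse_bounded (ltW r0_gt0) r02
  admissible_fine_continuous admissible_fine_inc.
have r2_ge0 : 0 <= r2 by rewrite ltW// (lt_le_trans r0_gt0).
have Fh s : G r0 <= s -> F (h s) = (Num.min s (G r2))%:E.
  by move=> /P[h_in Gh]; rewrite admissible_fineK// Gh.
have [_ _ _ F0] := hF.
(* Outside the convex set [r0 <= v_0], [-1 <= v_i <= 0] the value is 0 and F 0 = -oo. *)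
have dich (v : 'rV[R]_n.+1) :
    (G r0 <= v 0 0 /\ forall i : 'I_n, -1 <= v 0 (lift ord0 i) <= 0) \/
    times_cube h v = 0.
  have [/forallP hv|] := boolP [forall i : 'I_n, -1 <= v 0 (lift ord0 i) <= 0].
    have [v0|v0] := leP (G r0) (v 0 0); first by left.
    by right; rewrite times_cubeE// truncated_inverse0.
  by rewrite negb_forall => /existsP[i hi]; right; rewrite (times_cube0 _ hi).
split=> [v|x y l /andP[l0 l1]].
  split; first exact: times_cube_ge0 gb.
  apply: le_lt_trans r2a; rewrite lee_fin.
  have [[_ hv]|->//] := dich v.
  by rewrite times_cubeE//; have /andP[] := gb.2 (v 0 0).
have l1' : 0 < 1 - l by rewrite subr_gt0.
have [[x0 hx]|->] := dich x; last first.
  by rewrite F0 gt0_muleNy ?lte_fin// addNye leNye.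
have [[y0 hy]|->] := dich y; last first.
  by rewrite F0 gt0_muleNy ?lte_fin// addeNy leNye.
rewrite !times_cubeE//; last first.
  move=> i; rewrite !mxE; have /andP[? ?] := hx i; have /andP[? ?] := hy i.
  by apply/andP; split; nra.
rewrite !mxE !Fh//; last by nra.
rewrite -!EFinM -EFinD lee_fin le_min; apply/andP; split.
  by apply: lerD; rewrite ler_wpM2l ?ge_min ?lexx// ltW.
rewrite -[leRHS]mul1r -[in leRHS](subrK l 1) [leRHS]mulrDl.
by apply: lerD; rewrite ler_wpM2l ?ge_min ?lexx ?orbT// ltW.
Qed.

End truncated.
End F_concave_profile.

(** * Choice of the profile from a failure of log-concavity *)

Theorem proposition3p2 (R : realType) (a : \bar R) (F : R -> \bar R) (n : nat)
    (ha : (0 < a)%E) (hF : admissible a F) (hn : (2 <= n)%N)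
    (hweak : exists f : 'rV[R]_n -> R, F_concave a F f /\ ~ log_concave f) :
  exists phi : 'rV[R]_n -> R,
    [/\ F_concave a F phi, Linfty phi &
        exists t0 : R, 0 < t0 /\
          forall t : R, 0 < t -> t < t0 -> ~ quasi_concave (heat t phi)].
Proof.
case: n hn hweak => [//|[//|n]] _ [f [[f_in f_conc] /existsNP[x]]].
move=> /existsNP[y] /existsNP[l] /not_implyP[l01] /negP; rewrite -ltNge.
have [l0 l1] := andP l01; have l1' : 0 < 1 - l by rewrite subr_gt0.
have := f_conc x y l l01; set w := f (_ + _) => Fw fw.
have w_in : itv0 a w by exact: f_in.
(* A zero endpoint value would make the geometric mean 0, which cannot exceed [w]. *)
have fx0 : 0 < f x.
  rewrite lt_neqAle (f_in x).1 andbT; apply: contraL fw => /eqP <-.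
  by rewrite powR0 ?gt_eqF// mul0r -leNgt w_in.1.
have fy0 : 0 < f y.
  rewrite lt_neqAle (f_in y).1 andbT; apply: contraL fw => /eqP <-.
  by rewrite powR0 ?gt_eqF// mulr0 -leNgt w_in.1.
pose r1 := Num.min (f x) (f y); pose r2 := Num.max (f x) (f y).
have r1_gt0 : 0 < r1 by rewrite lt_min fx0.
have r12 : r1 <= r2 by rewrite ge_min !le_max lexx.
(* Positive, so that [F] is finite from [r0] on; strictly below [f x] and [f y], so that [h] is
   continuous at [G (f x)] and [G (f y)]. *)
pose r0 := r1 / 2.
have r0_gt0 : 0 < r0 by rewrite divr_gt0.
have r01 : r0 < r1 by rewrite /r0; lra.
have r02 : r0 <= r2 by exact: le_trans (ltW r01) r12.
have r2a : (r2%:E < a)%E.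
  by rewrite /r2 /Num.max; case: ifP => _; [exact: (f_in y).2|exact: (f_in x).2].
pose G := fine \o F; pose h := truncated_inverse G r0 r2.
have Gcont := admissible_fine_continuous hF r0_gt0 r2a.
have Ginc := admissible_fine_inc hF r0_gt0 r2a.
have GE := admissible_fineK hF r0_gt0 r2a.
have gb := truncated_inverse_bounded (ltW r0_gt0) r02 Gcont Ginc.
have hK := truncated_inverseK r02 Gcont Ginc.
have hc := truncated_inverse_continuous r02 Gcont Ginc.
have Gmono := le_mono_in Ginc.
have r0_in : r0 \in `[r0, r2] by rewrite in_itv/= lexx.
have r2_in : r2 \in `[r0, r2] by rewrite in_itv/= lexx andbT.
have x_in : f x \in `[r0, r2].
  by rewrite in_itv/= le_max lexx (le_trans (ltW r01))// ge_min lexx.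
have y_in : f y \in `[r0, r2].
  by rewrite in_itv/= le_max lexx orbT (le_trans (ltW r01))// ge_min lexx orbT.
have Gx : G r0 < G (f x) by apply: Ginc => //; rewrite (lt_le_trans r01)// ge_min lexx.
have Gy : G r0 < G (f y).
  by apply: Ginc => //; rewrite (lt_le_trans r01)// ge_min lexx orbT.
pose z := (1 - l) * G (f x) + l * G (f y).
have Gz : G r0 < z by rewrite /z; nra.
have z2 : z <= G r2.
  have : G (f x) <= G r2 by rewrite Gmono// le_max lexx.
  have : G (f y) <= G r2 by rewrite Gmono// le_max lexx orbT.
  by rewrite /z; nra.
have [hz_in] := truncated_inverseP r02 Gcont Ginc (ltW Gz).
rewrite -/h min_l// => Ghz.
have hz_gt0 : 0 < h z.
  by move: hz_in; rewrite in_itv/= => /andP[+ _]; exact: lt_le_trans.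
(* F-concavity of [f] gives z <= F w, while F (h z) = z. Hence [h z] inherits the strict inequality
   between [w] and the geometric mean of [f x] and [f y]. *)
have hzw : h z <= w.
  rewrite leNgt; apply/negP => wz; move: Fw; apply/negP; rewrite -ltNge.
  rewrite (GE _ x_in) (GE _ y_in) -!EFinM -EFinD -/z -Ghz -(GE _ hz_in).
  have [_ _ Finc _] := hF; apply: Finc => //; split; first exact: ltW.
  apply: le_lt_trans r2a; rewrite lee_fin.
  by move: hz_in; rewrite in_itv/= => /andP[].
exists (@times_cube R n.+2 h); split.
- exact: F_concave_times_cube.
- exact: Linfty_times_cube gb.
have : \forall t \near 0^'+, ~ quasi_concave (heat t (@times_cube R n.+2 h)).
  apply: (heat_times_cube_not_quasi_concave n gb l01 (hc _ Gx) (hc _ Gy)).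
  - exact: hc.
  - by rewrite hK.
  - by rewrite hK.
  - exact: hz_gt0.
  - by rewrite !hK//; exact: le_lt_trans fw.
move=> [t0 /= t0_gt0 ht]; exists t0; split=> // t t_gt0 tt0; apply: ht => //=.
by rewrite sub0r normrN gtr0_norm.
Qed.
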